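(* Suppose that $\chi=(Ay,-Ax,0)$ is a vector field on $\mathbb{T}^2$ for some $A\in\mathbb{R}[x,y,z]$. Then $s(\chi)\cap\mathbb{T}^2=\{A=0\}\cap\mathbb{T}^2$.
   Context: Fix a real number $a>1$ and let $\mathbb{T}^2=\{(x,y,z)\in\mathbb{R}^3:(x^2+y^2-a^2)^2+z^2-1=0\}$. A triple $\chi=(P,Q,R)$ with $P,Q,R\in\mathbb{R}[x,y,z]$ denotes the polynomial vector field $P\frac{\partial}{\partial x}+Q\frac{\partial}{\partial y}+R\frac{\partial}{\partial z}$ in $\mathbb{R}^3$, acting on polynomials as a derivation. It is called a vector field on $\mathbb{T}^2$ if $\chi F=KF$ for some $K\in\mathbb{R}[x,y,z]$, where $F=(x^2+y^2-a^2)^2+z^2-1$. The set of all singular points of $\chi$ (points where $P=Q=R=0$) is denoted $s(\chi)$. *)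

(* Defs.v *)
(* R^3 is 'rV[R]_3 for R : realType, and R[x,y,z] is
   {mpoly R[3]}, with x = 'X_0, y = 'X_1, z = 'X_2. *)
From mathcomp Require Import all_boot all_order all_algebra.
From mathcomp Require Import mpoly.
From mathcomp Require Import classical_sets reals.

Set Implicit Arguments.
Unset Strict Implicit.
Unset Printing Implicit Defensive.

Import Order.TTheory GRing.Theory Num.Theory.

Local Open Scope ring_scope.
Local Open Scope classical_set_scope.

Definition vfield (R : realType) : Type :=
  ({mpoly R[3]} * {mpoly R[3]} * {mpoly R[3]})%type.

Definition derivation (R : realType) (chi : vfield R) (f : {mpoly R[3]}) :
    {mpoly R[3]} :=
  let: (p, q, r) := chi in
  p * mderiv 0 f + q * mderiv 1 f + r * mderiv 2 f.

Definition zero_set (R : realType) (f : {mpoly R[3]}) : set 'rV[R]_3 :=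
  [set v | f.@[v 0] = 0].

Definition singular_points (R : realType) (chi : vfield R) : set 'rV[R]_3 :=
  let: (p, q, r) := chi in
  [set v | [/\ p.@[v 0] = 0, q.@[v 0] = 0 & r.@[v 0] = 0]].

Definition torus_poly (R : realType) (a : R) : {mpoly R[3]} :=
  ('X_0 ^+ 2 + 'X_1 ^+ 2 - (a ^+ 2)%:MP) ^+ 2 + 'X_2 ^+ 2 - 1.

Definition torus (R : realType) (a : R) : set 'rV[R]_3 :=
  [set v | (v 0 0 ^+ 2 + v 0 1 ^+ 2 - a ^+ 2) ^+ 2 + v 0 2 ^+ 2 - 1 = 0].

Definition vfield_on_torus (R : realType) (a : R) (chi : vfield R) : Prop :=
  exists K : {mpoly R[3]},
    derivation chi (torus_poly a) = K * torus_poly a.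

(* Main.v *)
Require Import Defs.
From mathcomp Require Import all_boot all_order all_algebra.
From mathcomp Require Import mpoly.
From mathcomp Require Import classical_sets reals.

Import Order.TTheory GRing.Theory Num.Theory.

Local Open Scope ring_scope.
Local Open Scope classical_set_scope.

(** The field vanishes at a point exactly when $Ay=Ax=0$ there, that is, when $A=0$ or the point
    lies on the $z$-axis. By [torus_off_axis] the torus misses that axis, so on it only $A=0$
    remains. *)

Lemma torus_off_axis (R : realType) (a : R) (v : 'rV[R]_3) :
  1 < a -> torus a v -> v 0 0 = 0 -> v 0 1 = 0 -> False.
Proof.
move=> ha + x0 y0; rewrite /torus /= x0 y0 expr0n addr0 sub0r sqrrN -exprM.
(* On the axis the left side of the equation is $a^4+z^2-1=(a^4-1)+z^2$, which is positive since
   $a>1$. *)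
apply/eqP; rewrite gt_eqF// addrAC ltr_wpDr ?sqr_ge0// subr_gt0.
by rewrite exprn_egt1.
Qed.

Theorem proposition2p8 (R : realType) (a : R) (ha : 1 < a)
    (A : {mpoly R[3]}) (chi : vfield R)
    (hchi : chi = (A * 'X_1, - A * 'X_0, 0))
    (hT : vfield_on_torus a chi) :
  singular_points chi `&` torus a = zero_set A `&` torus a.
Proof.
rewrite hchi; apply/seteqP; split=> v [] /=; rewrite /zero_set /=.
  rewrite !(mevalM, mevalN, mevalXU) => -[Ay Ax _] Tv; split=> //=.
  have [//|/eqP A0] := eqVneq A.@[v 0] 0.
  (* Where $A\neq 0$, cancelling $A$ in $-Ax=0$ and $Ay=0$ puts the point on the $z$-axis, a
     contradiction. *)
  case: (torus_off_axis _ _ _ ha Tv); apply/eqP.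
    by move/eqP: Ax; rewrite mulNr oppr_eq0 mulf_eq0 => /orP[/eqP|].
  by move/eqP: Ay; rewrite mulf_eq0 => /orP[/eqP|].
by move=> A0 Tv; split=> //; rewrite !(mevalM, mevalN) A0 oppr0 !mul0r meval0.
Qed.
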